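(* For any $p$ with $2<p<\infty$ there exists a weakly hypercyclic bilateral weighted shift acting on $\ell_p(\mathbb{Z})$ which is not supercyclic.
   Context: All spaces are complex. Given a bounded sequence $\{w_n\}_{n\in\mathbb{Z}}$ in $\mathbb{C}\setminus\{0\}$ (the weight sequence), the bilateral weighted shift $T$ on $\ell_p(\mathbb{Z})$ is the bounded linear operator defined on the canonical basis $\{e_n\}_{n\in\mathbb{Z}}$ by $Te_n=w_ne_{n-1}$. A bounded linear operator $T$ on a Banach space $\mathcal{B}$ is weakly hypercyclic if for some $x\in\mathcal{B}$ the orbit $\{T^nx:n=0,1,2,\dots\}$ is weakly dense in $\mathcal{B}$; it is supercyclic if for some $x\in\mathcal{B}$ the set $\{\lambda T^nx:n=0,1,2,\dots,\ \lambda\in\mathbb{C}\}$ is norm dense in $\mathcal{B}$. *)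

(* Defs.v *)
From HB Require Import structures.
From mathcomp Require Import all_boot all_order all_algebra.
From mathcomp Require Import all_classical all_reals all_analysis.
From mathcomp Require Import complex ring lra.

Set Implicit Arguments.
Unset Strict Implicit.
Unset Printing Implicit Defensive.

Import Order.TTheory GRing.Theory Num.Theory.
Import numFieldNormedType.Exports.
Import ComplexField.Normc.

Local Open Scope classical_set_scope.
Local Open Scope ring_scope.
Local Open Scope complex_scope.

Section linear_dynamics.
Context {K : numFieldType}.

Record dual_space (V : normedModType K) := DualSpace {
  functional :> {linear V -> K^o};
  functional_continuous : continuous functional
}.

(* The coarsest topology on V making every continuous functional continuous. *)
Definition weak_topology (V : normedModType K) : topologicalType :=
  sup_topology (fun f : dual_space V => Topological.on (initial_topology f)).

Definition weakly_hypercyclic (V : normedModType K) (T : V -> V) : Prop :=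
  exists x : V,
    @dense (weak_topology V) [set iter n T x | n in [set: nat]].

Definition supercyclic (V : normedModType K) (T : V -> V) : Prop :=
  exists x : V,
    @dense V [set l *: iter n T x | l in [set: K] & n in [set: nat]].

End linear_dynamics.

Section esum_extra.
Context {R : realType} {I : choiceType}.
Implicit Types (a : I -> \bar R) (c : R).
Local Open Scope ereal_scope.

Let le_esumZ a c : (0 <= c)%R -> (forall i, 0 <= a i) ->
  \esum_(i in [set: I]) (c%:E * a i) <= c%:E * \esum_(i in [set: I]) a i.
Proof.
move=> c0 a0; apply: ge_ereal_sup => _ [A fA <-].
rewrite -ge0_mule_fsumr// lee_wpmul2l ?lee_fin//.
by apply: ereal_sup_ubound; exists A.
Qed.

Lemma esumZ a c : (0 <= c)%R -> (forall i, 0 <= a i) ->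
  \esum_(i in [set: I]) (c%:E * a i) = c%:E * \esum_(i in [set: I]) a i.
Proof.
rewrite le_eqVlt => /predU1P[<- a0|c0 a0].
  by rewrite mul0e esum1// => i _; rewrite mul0e.
apply/eqP; rewrite eq_le (le_esumZ (ltW c0) a0)/=.
have cV i : a i = (c^-1)%:E * (c%:E * a i).
  by rewrite muleA -EFinM mulVf ?mul1e// gt_eqF.
rewrite (eq_esum (fun i _ => cV i)).
apply: (@le_trans _ _ (c%:E * ((c^-1)%:E *
    \esum_(i in [set: I]) (c%:E * a i)))).
  apply: lee_wpmul2l; first by rewrite lee_fin ltW.
  apply: le_esumZ => [|i]; first by rewrite invr_ge0 ltW.
  by rewrite mule_ge0// lee_fin ltW.
by rewrite muleA -EFinM divff ?gt_eqF// mul1e.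
Qed.

End esum_extra.

Section lp_space.
Context {R : realType}.
Variables (p : R) (p1 : 1 <= p).
Implicit Types x y : int -> R[i].

Definition lp_sum x : \bar R :=
  (\esum_(n in [set: int]) ((normc (x n)) `^ p)%:E)%E.

(* The unused argument lets the instances on lp below, which need 1 <= p,
   recover this proof by unification. *)
Definition lp_pred of 1 <= p : {pred int -> R[i]} :=
  mem [set x | (lp_sum x < +oo)%E].

Let p_gt0 : 0 < p. Proof. exact: lt_le_trans p1. Qed.

Let normc_ge0 (z : R[i]) : 0 <= normc z.
Proof. by case: z => a b; exact: sqrtr_ge0. Qed.

Lemma lp_sum_ge0 x : (0 <= lp_sum x)%E.
Proof. by apply: esum_ge0 => n _; rewrite lee_fin powR_ge0. Qed.

Lemma lp_sumZ l x : lp_sum (l *: x) = ((normc l `^ p)%:E * lp_sum x)%E.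
Proof.
rewrite -esumZ ?powR_ge0//; last by move=> n; rewrite lee_fin powR_ge0.
by apply: eq_esum => n _; rewrite -EFinM -powRM// -normcM.
Qed.

Let powR_div (u a : R) : 0 <= u -> 0 <= a -> (u / a) `^ p = u `^ p / a `^ p.
Proof.
move=> u0 a0; rewrite powRM ?invr_ge0//.
by rewrite -powR_inv1// powRAC powR_inv1 ?powR_ge0.
Qed.

Let powR_le_inv (a b : R) : 0 <= a -> 0 <= b -> a `^ p <= b `^ p -> a <= b.
Proof.
move=> a0 b0; apply: contraTT; rewrite -!ltNge => ba.
by rewrite gt0_ltr_powR.
Qed.

Let powRD_le (a b u v : R) : 0 < a -> 0 < b -> 0 <= u -> 0 <= v ->
  (u + v) `^ p <= (a + b) `^ p *
    (a / (a + b) * (u `^ p / a `^ p) + b / (a + b) * (v `^ p / b `^ p)).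
Proof.
move=> a0 b0 u0 v0; have ab0 : 0 < a + b by exact: addr_gt0.
have [a0' b0' ab0'] : [/\ 0 <= a, 0 <= b & 0 <= a + b] by split; exact: ltW.
have t0 : 0 <= a / (a + b) by exact: divr_ge0.
have t1 : a / (a + b) <= 1 by rewrite ler_pdivrMr// mul1r lerDl.
have itv_ge0 (z : R) : 0 <= z -> z \in (`[0, +oo[%classic : set R).
  by move=> z0; rewrite inE/= in_itv/= z0.
have : (a / (a + b) * (u / a) + (1 - a / (a + b)) * (v / b)) `^ p <=
    a / (a + b) * (u / a) `^ p + (1 - a / (a + b)) * (v / b) `^ p.
  exact: (convex_powR p1 (Itv01 t0 t1) (itv_ge0 _ (divr_ge0 u0 a0'))
    (itv_ge0 _ (divr_ge0 v0 b0'))).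
have -> : 1 - a / (a + b) = b / (a + b) by field; rewrite gt_eqF.
rewrite !powR_div//.
move=> /(ler_wpM2l (powR_ge0 (a + b) p)); rewrite -powRM//; last first.
  by rewrite addr_ge0// mulr_ge0// divr_ge0.
by apply: le_trans; rewrite le_eqVlt; apply/orP; left; apply/eqP; congr powR;
  field; rewrite !gt_eqF.
Qed.

Lemma lp_sumD x y (a b : R) : 0 < a -> 0 < b ->
  (lp_sum x <= (a `^ p)%:E)%E -> (lp_sum y <= (b `^ p)%:E)%E ->
  (lp_sum (x + y)%R <= ((a + b) `^ p)%:E)%E.
Proof.
move=> a0 b0 xa yb; have ab0 : 0 < a + b by exact: addr_gt0.
pose ca := (a + b) `^ p * (a / (a + b) * (a `^ p)^-1).
pose cb := (a + b) `^ p * (b / (a + b) * (b `^ p)^-1).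
have ca0 : 0 <= ca by rewrite mulr_ge0 ?powR_ge0// mulr_ge0 ?invr_ge0 ?powR_ge0// divr_ge0// ltW.
have cb0 : 0 <= cb by rewrite mulr_ge0 ?powR_ge0// mulr_ge0 ?invr_ge0 ?powR_ge0// divr_ge0// ltW.
apply: (@le_trans _ _ (ca%:E * lp_sum x + cb%:E * lp_sum y)%E).
  rewrite -!esumZ//; try by move=> n; rewrite lee_fin powR_ge0.
  rewrite -esumD; try by move=> n _; rewrite -EFinM lee_fin mulr_ge0 ?powR_ge0.
  apply: le_esum => n _; rewrite -!EFinM -EFinD lee_fin.
  apply: (@le_trans _ _ ((normc (x n) + normc (y n)) `^ p)).
    by rewrite ge0_ler_powR ?nnegrE ?addr_ge0 ?(ltW p_gt0)//; exact: le_normcD.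
  apply: (le_trans (powRD_le a0 b0 _ _)) => //.
  by rewrite /ca /cb; lra.
apply: (@le_trans _ _ (ca%:E * (a `^ p)%:E + cb%:E * (b `^ p)%:E)%E).
  by rewrite leeD// lee_wpmul2l// lee_fin.
rewrite -!EFinM -EFinD lee_fin /ca /cb le_eqVlt; apply/orP; left; apply/eqP.
by field; rewrite !gt_eqF ?powR_gt0.
Qed.

Definition lp_norm x : R := (fine (lp_sum x)) `^ p^-1.

Lemma lp_norm_powR x : x \in lp_pred p1 -> (lp_norm x `^ p)%:E = lp_sum x.
Proof.
rewrite inE /lp_pred/= => xoo.
rewrite /lp_norm -powRrM mulVf ?gt_eqF// powRr1 ?fine_ge0 ?lp_sum_ge0//.
by rewrite fineK// ge0_fin_numE// lp_sum_ge0.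
Qed.

Lemma lp_norm_ge0 x : 0 <= lp_norm x. Proof. exact: powR_ge0. Qed.

#[local] Hint Resolve lp_sum_ge0 lp_norm_ge0 : core.

Let lp_sum_le x a : x \in lp_pred p1 -> lp_norm x <= a ->
  (lp_sum x <= (a `^ p)%:E)%E.
Proof.
move=> xp xa; rewrite -lp_norm_powR// lee_fin ge0_ler_powR ?nnegrE ?(ltW p_gt0)//.
exact: le_trans xa.
Qed.

Let lp_predD x y : x \in lp_pred p1 -> y \in lp_pred p1 -> x + y \in lp_pred p1.
Proof.
move=> xp yp; rewrite inE /lp_pred/=.
apply: le_lt_trans (lp_sumD (a := lp_norm x + 1) (b := lp_norm y + 1) _ _ _ _) _;
  rewrite ?ltry ?ltr_wpDl//; by apply: lp_sum_le => //; rewrite lerDl.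
Qed.

Lemma lp_submod_closed : submod_closed (lp_pred p1).
Proof.
split=> [|l x y xp yp].
  rewrite inE /lp_pred/= /lp_sum esum1 ?ltry// => n _.
  by rewrite normc0 powR0// gt_eqF.
apply: lp_predD => //; rewrite inE /lp_pred/= lp_sumZ.
by rewrite -lp_norm_powR// -EFinM ltry.
Qed.

HB.instance Definition _ :=
  GRing.isSubmodClosed.Build R[i] (int -> R[i]) (lp_pred p1) lp_submod_closed.

Record lp (q1 : 1 <= p) := Lp {
  lp_val :> int -> R[i];
  _ : lp_val \in lp_pred q1
}.

HB.instance Definition _ := [isSub for @lp_val p1].
HB.instance Definition _ := [Choice of lp p1 by <:].
HB.instance Definition _ := [SubChoice_isSubLmodule of lp p1 by <:].

Implicit Types f g : lp p1.

Lemma lp_valP f : (f : int -> R[i]) \in lp_pred p1. Proof. exact: (valP f). Qed.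

Lemma lp_sum_norm f : lp_sum f = (lp_norm f `^ p)%:E.
Proof. by rewrite lp_norm_powR// lp_valP. Qed.

(* normedModType R[i] requires an R[i]-valued norm. *)
Definition lp_normC f : R[i] := (lp_norm f)%:C.

Let lp_normD f g : lp_normC (f + g) <= lp_normC f + lp_normC g.
Proof.
rewrite /lp_normC -rmorphD/= lecR; apply/ler_addgt0Pr => e e0.
have e20 : 0 < e / 2 by rewrite divr_gt0.
have h (N : R) : 0 <= N -> 0 < N + e / 2 by move=> N0; rewrite ltr_wpDl.
have le_pow : (lp_sum (f + g)%R <=
    (((lp_norm f + e / 2) + (lp_norm g + e / 2)) `^ p)%:E)%E.
  apply: lp_sumD; [exact: h|exact: h| |].
    by apply: (lp_sum_le (lp_valP f)); rewrite lerDl ltW.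
  by apply: (lp_sum_le (lp_valP g)); rewrite lerDl ltW.
move: le_pow; rewrite lp_sum_norm lee_fin addrACA -splitr => le_pow.
apply: powR_le_inv le_pow; first exact: lp_norm_ge0.
apply: addr_ge0 (ltW e0); exact: addr_ge0 (lp_norm_ge0 _) (lp_norm_ge0 _).
Qed.

Let lp_normZ (l : R[i]) f : lp_normC (l *: f) = `|l| * lp_normC f.
Proof.
rewrite /lp_normC -[`|l|]/((normc l)%:C) -rmorphM/=; congr (_%:C).
have lf : lp_sum (l *: f)%R = ((normc l `^ p)%:E * lp_sum f)%E.
  exact: lp_sumZ.
rewrite /lp_norm lf fineM//; last by rewrite lp_sum_norm.
rewrite /= powRM ?powR_ge0 ?fine_ge0//.
by rewrite -powRrM mulfV ?gt_eqF// powRr1.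
Qed.

Let lp_norm_eq0 f : lp_normC f = 0 -> f = 0.
Proof.
move=> [f0]; apply/val_inj/funext => n /=.
have := lp_sum_norm f; rewrite f0 powR0 ?gt_eqF// => s0.
apply: eq0_normc.
have le_sum : ((normc (f n) `^ p)%:E <= lp_sum f)%E.
  apply: ereal_sup_ubound; exists [set n]; last by rewrite fsbig_set1.
  by split=> //; exact: finite_set1.
apply/eqP; rewrite eq_le normc_ge0 andbT; apply: powR_le_inv => //.
by rewrite powR0 ?gt_eqF// -lee_fin -s0.
Qed.

HB.instance Definition _ :=
  Lmodule_isNormed.Build R[i] (lp p1) lp_normD lp_normZ lp_norm_eq0.

Lemma lp_normE f : `|f| = (lp_norm f)%:C. Proof. by []. Qed.

Let lp_basis_subproof (n : int) : (fun m => (m == n)%:R) \in lp_pred p1.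
Proof.
rewrite inE /lp_pred/= /lp_sum.
rewrite (_ : esum _ _ = \esum_(m in [set n]) 1%E)%E.
  by rewrite esum_set1 ?ltry.
rewrite [RHS]esum_mkcond; apply: eq_esum => m _.
case: eqVneq => [->|/eqP mn]; first by rewrite mem_set// normc1 powR1.
by rewrite memNset// normc0 powR0// gt_eqF.
Qed.

Definition lp_basis (n : int) : lp p1 := Lp (lp_basis_subproof n).

(* Boundedness of T is stated as continuity, which is equivalent for linear
   maps by linear_bounded_continuous; together with the values on the basis it
   determines T. *)
Definition bilateral_weighted_shift (w : int -> R[i])
    (T : {linear lp p1 -> lp p1}) : Prop :=
  [/\ forall n, w n != 0, exists M : R, forall n, normc (w n) <= M,
      continuous T & forall n, T (lp_basis n) = w n *: lp_basis (n - 1)].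

End lp_space.

(* Main.v *)
Require Import Defs.
From HB Require Import structures.
From mathcomp Require Import all_boot all_order all_algebra.
From mathcomp Require Import all_classical all_reals all_analysis.
From mathcomp Require Import complex ring lra zify.

(** Let [a = wt] be a positive function on the integers with bounded ratios of
neighbouring values, [e_n] the canonical basis and [E_n = a n *: e_n]. The
shift with weights [w_n = a (n - 1) / a n] satisfies [T^m E_n = E_(n - m)], so
everything is decided by the choice of [a].

Supercyclicity is excluded by the symmetry [a (- n) * a n = 1]. If multiples of
[T^m x] and [T^n x], with [m <> n], are both close to [e_0], then the
coordinate [n - m] of the first and the coordinate [m - n] of the second are
small; but by the symmetry their product equals the product of the two
coordinates at 0, which is close to 1.

For weak hypercyclicity, the indices are cut into blocks
[4^c <= j < 4^(c+1)], and a pattern (a finite list of positions with rational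
complex coefficients) is attached to each [c] so that every pattern recurs
infinitely often. The vector [x] carries, for each [j] in block [c], a copy of
pattern [c] translated to the position [4^j]. The function [a] drops to
[2^-c] at these positions, so block [c] contributes a norm of the order of
[4^(c/p) * 2^-c], which is summable exactly because [p > 2].

For [k] in block [b], [T^(4^k) x] is the sum of the target vector of
pattern [b] and of an error that carries copies at the positions [4^j - 4^k],
[j <> k], where [a] is at most [2 * 2^(b - c)]. One such error has norm of the
order of [2^b], hence the orbit does not approach the target in norm. But the
numbers [4^j - 4^k] are pairwise distinct, so the errors of one block are
essentially disjointly supported, and any combination of them with
coefficients of modulus at most 1 has norm of the order of [2^b * 4^(b/p)]
([error_norm]). Choosing the coefficients to be the phases of a functional [f]
at the errors, the average of [|f error|] over the at least [4^b] indices of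
the block is of the order of [(4^(1/p) / 2)^b], which tends to 0. Hence, given
finitely many functionals, some error in a late block is small for all of them
([error_weakly_small]); as the targets are norm dense ([target_dense]), the
orbit of [x] is weakly dense. *)

Set Implicit Arguments.
Unset Strict Implicit.
Unset Printing Implicit Defensive.

Import Order.TTheory GRing.Theory Num.Theory.
Import numFieldNormedType.Exports.
Import ComplexField.Normc.

(** * The depth of the weights *)

Section depth.
Local Open Scope nat_scope.

(** The number of the block containing [j]. *)
Definition scale (j : nat) : nat := trunc_log 4 j.
(** Depth attained at distance [d] from a centre: at the distances [4 ^ k] that
matter it equals [scale k], and it grows slowly enough to be 1-Lipschitz. *)
Definition llog (d : nat) : nat := scale (scale d).
Definition gap (m n : nat) : nat := (m - n) + (n - m).
(** The base 2 logarithm of the inverse of the weight at [n >= 0]: a dip of depth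
[scale j] around each centre [4 ^ j], which at distance [4 ^ k] has
decreased to [scale j - scale k]. Centres beyond [n] are left out to have a
finite maximum; at [n] their dips would have depth at most 1. *)
Definition dip (n : nat) : nat := \max_(j < n.+1) (scale j - llog (gap n (4 ^ j))).

Lemma scaleS n : scale n.+1 <= (scale n).+1.
Proof.
case: n => [|n]; first by rewrite /scale trunc_log1.
rewrite /scale -trunc_logMp//; apply: leq_trunc_log; lia.
Qed.

Lemma leq_scale : {homo scale : m n / m <= n}.
Proof. by move=> m n; exact: leq_trunc_log. Qed.

Lemma leq_llog : {homo llog : m n / m <= n}.
Proof. by move=> m n mn; do 2 apply: leq_scale. Qed.

Lemma llogS n : llog n.+1 <= (llog n).+1.
Proof. exact: leq_trans (leq_scale (scaleS n)) (scaleS _). Qed.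

Lemma llog_exp k : llog (4 ^ k) = scale k.
Proof. by rewrite /llog /scale trunc_expnK. Qed.

Lemma scaleW n : scale n <= (scale n.-1).+1.
Proof. by case: n => // n; exact: scaleS. Qed.

Lemma dip_ge n j : j <= n -> scale j - llog (gap n (4 ^ j)) <= dip n.
Proof.
move=> jn.
exact: (leq_bigmax (F := fun j : 'I_n.+1 => scale j - llog (gap n (4 ^ j)))
  (Ordinal (jn : j < n.+1))).
Qed.

Lemma dip0 : dip 0 = 0.
Proof. by rewrite /dip big_ord_recl big_ord0 /= /scale trunc_log0. Qed.

Lemma llog_dist (m n : nat) a : gap m n <= 1 -> llog (gap m a) <= (llog (gap n a)).+1.
Proof.
move=> mn; apply: leq_trans (llogS _); apply: leq_llog; move: mn; rewrite /gap; lia.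
Qed.

Lemma dip_leS n : dip n <= (dip n.+1).+1.
Proof.
apply/bigmax_leqP => j _.
have jn : j <= n.+1 by have := ltn_ord j; lia.
have := dip_ge jn.
have := @llog_dist n.+1 n (4 ^ j) ltac:(rewrite /gap; lia); lia.
Qed.

Lemma ltn_exp4 n : n < 4 ^ n. Proof. exact: ltn_expl. Qed.

(** The centre [4 ^ n.+1] enters the maximum at [n.+1], but it is still so far
away that it contributes at most 1. *)
Lemma dip_geS n : dip n.+1 <= (dip n).+1.
Proof.
apply/bigmax_leqP => j _.
have := ltn_ord j; rewrite ltnS leq_eqVlt => /predU1P[->|jn].
  have : 4 ^ n <= gap n.+1 (4 ^ n.+1) by rewrite /gap; have := ltn_exp4 n; rewrite expnS; lia.
  by move=> /leq_llog; rewrite llog_exp; have := scaleS n; lia.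
have := dip_ge (jn : j <= n).
have := @llog_dist n n.+1 (4 ^ j) ltac:(rewrite /gap; lia); lia.
Qed.

Lemma leq_exp4S i j : i < j -> 4 * 4 ^ i <= 4 ^ j.
Proof. by move=> ij; rewrite -expnS leq_exp2l. Qed.

Lemma dip_exp j : scale j <= dip (4 ^ j).
Proof.
have := dip_ge (ltnW (ltn_exp4 j)).
by rewrite /gap subnn /llog /scale trunc_log0 subn0.
Qed.

Lemma dip_gap_ge j k : k < j -> scale j - scale k <= dip (4 ^ j - 4 ^ k).
Proof.
move=> kj; have h1 := leq_exp4S kj.
have j_le : j <= 4 ^ j - 4 ^ k.
  case: j kj h1 => // j kj; rewrite expnS; have := ltn_exp4 j; lia.
have := dip_ge j_le.
have -> : gap (4 ^ j - 4 ^ k) (4 ^ j) = 4 ^ k by rewrite /gap; lia.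
by rewrite llog_exp.
Qed.

(** All centres compete at [4 ^ j - 4 ^ k]. Centres beyond [j] are at distance
at least [4 ^ i.-1] and hence contribute at most 1; centres before [j] are at
distance at least their own size and contribute nothing. *)
Lemma dip_gap_le j k : k < j -> dip (4 ^ j - 4 ^ k) <= (scale j - scale k).+1.
Proof.
move=> kj; have h1 := leq_exp4S kj.
have skj := leq_scale (ltnW kj).
apply/bigmax_leqP => -[i /= _] _.
have [ij|ji|->] := ltngtP i j; last 1 first.
- have -> : gap (4 ^ j - 4 ^ k) (4 ^ j) = 4 ^ k by rewrite /gap; lia.
  by rewrite llog_exp; lia.
- have : 4 ^ i <= gap (4 ^ j - 4 ^ k) (4 ^ i) by rewrite /gap; have := leq_exp4S ij; lia.
  by move=> /leq_llog; rewrite llog_exp; lia.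
- have : 4 ^ i.-1 <= gap (4 ^ j - 4 ^ k) (4 ^ i).
    by rewrite /gap; case: i ji => // i ji; have := leq_exp4S ji; rewrite /= expnS; lia.
  by move=> /leq_llog; rewrite llog_exp; have := scaleW i; lia.
Qed.

(** A sum of two powers of 4 determines the larger one, because the next power
is more than twice as large. *)
Lemma exp4_sum_inj a b c d : 4 ^ a + 4 ^ b = 4 ^ c + 4 ^ d ->
  (a = c /\ b = d) \/ (a = d /\ b = c).
Proof.
have inj i j : 4 ^ i = 4 ^ j -> i = j by move/eqP; rewrite eqn_exp2l// => /eqP.
wlog : a b c d / [&& b <= a, d <= c & c <= a].
  move=> H e; have [ba|/ltnW ab] := leqP b a; have [dc|/ltnW cd] := leqP d c.
  - have [ca|/ltnW ac] := leqP c a; first by apply: H => //; apply/and3P.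
    have := H c d a b; rewrite ba dc ac => /(_ erefl); lia.
  - have [da|/ltnW ad] := leqP d a.
      have := H a b d c; rewrite ba cd da => /(_ erefl); lia.
    have := H d c a b; rewrite ba cd ad => /(_ erefl); lia.
  - have [cb|/ltnW bc] := leqP c b.
      have := H b a c d; rewrite ab dc cb => /(_ erefl); lia.
    have := H c d b a; rewrite ab dc bc => /(_ erefl); lia.
  - have [db|/ltnW bd] := leqP d b.
      have := H b a d c; rewrite ab cd db => /(_ erefl); lia.
    have := H d c b a; rewrite ab cd bd => /(_ erefl); lia.
move=> /and3P[ba dc ca] e.
have [ca'|ac'|ca'] := ltngtP c a.
- have := leq_exp4S ca'; have : 4 ^ d <= 4 ^ c by rewrite leq_exp2l.
  have := ltn_exp4 c; lia.
- lia.
- left; split => //; apply: inj; rewrite ca' in e; lia.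
Qed.

End depth.

Local Open Scope classical_set_scope.
Local Open Scope ring_scope.
Local Open Scope complex_scope.

(** * Real and complex scalars *)

Section scalars.
Variable R : realType.
Implicit Types (a b e : R) (z : R[i]).

Lemma normc_ge0 z : 0 <= normc z.
Proof. by case: z => a b; exact: sqrtr_ge0. Qed.

Lemma normc_real_ge0 a : 0 <= a -> normc a%:C = a.
Proof. by move=> a0; rewrite /= expr0n/= addr0 sqrtr_sqr ger0_norm. Qed.

Lemma powR_exprn (a r : R) n : 0 <= a -> (a ^+ n) `^ r = (a `^ r) ^+ n.
Proof.
move=> a0; rewrite -(powR_mulrn _ a0) -powRrM mulrC powRrM.
by rewrite powR_mulrn ?powR_ge0.
Qed.

Lemma expr_small (a e : R) : 0 <= a < 1 -> 0 < e ->
  exists N, forall c, (N <= c)%N -> a ^+ c < e.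
Proof.
move=> /andP[a0 a1] e0.
have : (fun n => a ^+ n) @ \oo --> (0 : R) by apply: cvg_expr; rewrite ger0_norm.
move=> /cvgr0Pnorm_lt /(_ _ e0)[N _ hN]; exists N => c Nc.
by have := hN c Nc; rewrite /= ger0_norm// exprn_ge0.
Qed.

Lemma normc_phase (z : R[i]) : exists2 u, normc u <= 1 & u * z = (normc z)%:C.
Proof.
have [->|z0] := eqVneq z 0; first by exists 0; rewrite ?mul0r normc0.
exists ((normc z)%:C / z); last by rewrite divfK.
rewrite normcM normcV normc_real_ge0 ?normc_ge0// divff//.
by apply: contra z0 => /eqP/eq0_normc->.
Qed.

Lemma rat_approx (a e : R) : 0 < e -> exists q : rat, `|a - ratr q| < e.
Proof.
move=> e0; have [|q] := @rat_in_itvoo R (a - e) (a + e); first by lra.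
by rewrite in_itv/= => /andP[h1 h2]; exists q; rewrite ltr_norml; lra.
Qed.

Lemma normc_le_abs (a b : R) : normc (a +i* b) <= `|a| + `|b|.
Proof.
have -> : a +i* b = a%:C + (0 +i* b).
  by apply/eqP; rewrite eq_complex /= addr0 add0r !eqxx.
apply: le_trans (le_normcD _ _) _.
by rewrite /= expr0n/= addr0 add0r !sqrtr_sqr.
Qed.

End scalars.

(** * The weights *)

Section weights.
Variable R : realType.

(** The reciprocal values on the negative side give [wtNM], which is what
excludes supercyclicity. *)
Definition wt (n : int) : R :=
  match n with Posz n => (2 ^+ dip n)^-1 | Negz n => 2 ^+ dip n.+1 end.

Let pow2_gt0 n : 0 < 2 ^+ n :> R. Proof. by rewrite exprn_gt0. Qed.

Lemma wt_gt0 n : 0 < wt n.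
Proof. by case: n => n /=; rewrite ?invr_gt0. Qed.

Let pow2_le m n : (m <= n)%N -> 2 ^+ m <= 2 ^+ n :> R.
Proof. by move=> mn; rewrite ler_eXn2l// ltr1n. Qed.

Lemma wt0 : wt 0 = 1.
Proof. by rewrite -[LHS]/((2 ^+ dip 0)^-1) dip0 expr0 invr1. Qed.

Lemma wtNM n : wt (- n) * wt n = 1.
Proof.
case: n => [[|n]|n]; first by rewrite oppr0 wt0 mulr1.
- by rewrite (_ : - n.+1%:Z = Negz n)//= mulfV ?gt_eqF.
- by rewrite NegzE opprK /= mulVf ?gt_eqF.
Qed.

Let wt_step_pos (n : nat) : wt n.+1 <= 2 * wt n /\ wt n <= 2 * wt n.+1.
Proof.
split; rewrite /= ler_pdivlMr// mulrC ler_pdivrMr// -exprS pow2_le//.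
  exact: dip_leS.
exact: dip_geS.
Qed.

Lemma wt_step n : wt (n + 1) <= 2 * wt n /\ wt n <= 2 * wt (n + 1).
Proof.
case: n => [n|n].
  have -> : n%:Z + 1 = n.+1 by lia.
  exact: wt_step_pos.
have inv m : wt (- m) = (wt m)^-1.
  by apply/(mulIf (lt0r_neq0 (wt_gt0 m))); rewrite wtNM mulVf ?gt_eqF ?wt_gt0.
have [h1 h2] := wt_step_pos n.
rewrite NegzE (_ : - n.+1%:Z + 1 = - n%:Z); last by lia.
rewrite !inv; have v0 := wt_gt0 n; have v1 := wt_gt0 n.+1.
by split; rewrite ler_pdivlMr// mulrC ler_pdivrMr.
Qed.

Lemma wt_shift d i : wt (d + i) <= 2 ^+ `|i|%N * wt d.
Proof.
have up (e : int) (m : nat) : wt (e + m) <= 2 ^+ m * wt e /\ wt e <= 2 ^+ m * wt (e + m).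
  elim: m => [|m [h1 h2]]; first by rewrite addr0 expr0 mul1r.
  have [s1 s2] := wt_step (e + m).
  rewrite (_ : e + m.+1 = e + m + 1) 1?exprS; last by lia.
  split.
    by apply: (le_trans s1); rewrite -mulrA ler_pM2l.
  apply: (le_trans h2); rewrite [2 * _]mulrC -mulrA ler_pM2l//.
case: i => [m|m]; first exact: (up d m).1.
rewrite NegzE abszN absz_nat.
by have := (up (d - m.+1%:Z) m.+1).2; rewrite subrK.
Qed.

Lemma wt_exp j : wt (4 ^ j)%N <= (2 ^+ scale j)^-1.
Proof. by rewrite /= lef_pV2 ?posrE// pow2_le// dip_exp. Qed.

(** The same bound holds on both sides of 0: for [k < j] it uses the lower bound
on the depth and for [j < k], where the weight is large, the upper bound, which
costs the factor 2. *)
Lemma wt_gap j k : j != k ->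
  wt ((4 ^ j)%N%:Z - (4 ^ k)%N%:Z) <= 2 * 2 ^+ scale k / 2 ^+ scale j.
Proof.
rewrite neq_ltn => /orP[jk|kj].
  have h1 := leq_exp4S jk; have h2 := ltn_exp4 j.
  rewrite (_ : _ - _ = Negz (4 ^ k - 4 ^ j).-1); last by lia.
  rewrite /= prednK; last by lia.
  rewrite ler_pdivlMr// -exprD -exprS pow2_le//.
  by have := dip_gap_le jk; have := leq_scale (ltnW jk); lia.
have h1 := leq_exp4S kj; have h2 := ltn_exp4 k.
rewrite (_ : _ - _ = Posz (4 ^ j - 4 ^ k)); last by lia.
rewrite /= ler_pdivlMr// mulrC ler_pdivrMr// -exprS -exprD pow2_le//.
by have := dip_gap_ge kj; lia.
Qed.

End weights.

(** * Norms in the sequence space *)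

Section lp_lemmas.
Context {R : realType}.
Variables (p : R) (p1 : 1 <= p).
Implicit Types (x y : lp p1).

Let p_gt0 : 0 < p. Proof. exact: lt_le_trans p1. Qed.

Lemma lp_ext x y : (forall n, x n = y n) -> x = y.
Proof. by move=> xy; apply: val_inj; apply: funext. Qed.

Lemma lp_valD x y n : (x + y) n = x n + y n. Proof. by []. Qed.
Lemma lp_valB x y n : (x - y) n = x n - y n. Proof. by []. Qed.
Lemma lp_valZ (l : R[i]) x n : (l *: x) n = l * x n. Proof. by []. Qed.
Lemma lp_val_sum I (r : seq I) (F : I -> lp p1) n :
  (\sum_(i <- r) F i) n = \sum_(i <- r) F i n.
Proof. by elim: r => [|i r IH]; rewrite ?big_nil// !big_cons lp_valD IH. Qed.

Lemma lp_basisE n m : lp_basis p1 n m = (m == n)%:R. Proof. by []. Qed.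

Lemma lp_normD x y : lp_norm p (x + y) <= lp_norm p x + lp_norm p y.
Proof. by have := ler_normD x y; rewrite !lp_normE -rmorphD lecR. Qed.

Lemma lp_normZ l x : lp_norm p (l *: x) = normc l * lp_norm p x.
Proof.
have := normrZ l x; rewrite !lp_normE -[`|l|]/((normc l)%:C) -rmorphM.
exact: complexI.
Qed.

Lemma lp_norm0 : lp_norm p (0 : lp p1) = 0.
Proof. by have := @normr0 _ (lp p1); rewrite lp_normE => /complexI. Qed.

Lemma lp_norm_sum I (r : seq I) (F : I -> lp p1) :
  lp_norm p (\sum_(i <- r) F i) <= \sum_(i <- r) lp_norm p (F i).
Proof.
elim: r => [|i r IH]; first by rewrite !big_nil lp_norm0.
by rewrite !big_cons (le_trans (lp_normD _ _))// lerD2l.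
Qed.

Lemma lp_norm_le x (b : R) : 0 <= b ->
  (lp_sum p x <= (b `^ p)%:E)%E -> lp_norm p x <= b.
Proof.
move=> b0; rewrite lp_sum_norm lee_fin; apply: contraTT; rewrite -!ltNge => h.
by rewrite gt0_ltr_powR ?nnegrE ?lp_norm_ge0 ?normc_ge0.
Qed.

Lemma lp_sum_le x (b : R) : lp_norm p x <= b -> (lp_sum p x <= (b `^ p)%:E)%E.
Proof.
move=> xb; rewrite lp_sum_norm lee_fin ge0_ler_powR ?nnegrE ?(ltW p_gt0)//.
  exact: lp_norm_ge0.
by apply: le_trans xb; exact: lp_norm_ge0.
Qed.

Lemma le_lp_sum_seq (r : seq int) (x : int -> R[i]) : uniq r ->
  (\sum_(i <- r) (normc (x i) `^ p)%:E <= lp_sum p x)%E.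
Proof.
move=> ur; apply: ereal_sup_ubound; exists [set` r]; first by split => //; exact: finite_seq.
by rewrite -(fsbig_seq _ _ ur).
Qed.

Lemma lp_sum_sup (x : int -> R[i]) (b : R) :
  (forall r : seq int, uniq r -> \sum_(i <- r) (normc (x i) `^ p) <= b) ->
  (lp_sum p x <= b%:E)%E.
Proof.
move=> h; apply: ge_ereal_sup => _ [A [fA _] <-].
rewrite fsbig_finite//= sumEFin lee_fin; apply: h; exact: finmap.fset_uniq.
Qed.

Lemma normc_le_lp_norm x n : normc (x n) <= lp_norm p x.
Proof.
have := @le_lp_sum_seq [:: n] x erefl.
rewrite big_seq1 lp_sum_norm lee_fin; apply: contraTT; rewrite -!ltNge => h.
by rewrite gt0_ltr_powR ?nnegrE ?lp_norm_ge0 ?normc_ge0.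
Qed.

Lemma lp_sum_disjoint x y : (forall n, x n = 0 \/ y n = 0) ->
  lp_sum p (x + y : lp p1) = (lp_sum p x + lp_sum p y)%E.
Proof.
move=> xy; rewrite /lp_sum -esumD; try by move=> n _; rewrite lee_fin powR_ge0.
apply: eq_esum => n _; rewrite -EFinD; congr EFin.
rewrite lp_valD.
by case: (xy n) => ->; rewrite normc0 (powR0 (lt0r_neq0 p_gt0)) ?add0r ?addr0.
Qed.

Lemma lp_sum_basis (a : R[i]) n : lp_sum p (a *: lp_basis p1 n) = (normc a `^ p)%:E.
Proof.
rewrite /lp_sum -(@esum_set1 R _ n (fun=> (normc a `^ p)%:E)) ?lee_fin ?powR_ge0//.
rewrite [RHS]esum_mkcond; apply: eq_esum => m _.
rewrite lp_valZ lp_basisE; case: eqVneq => [->|/eqP mn].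
  by rewrite mem_set// mulr1.
by rewrite memNset// mulr0 normc0 (powR0 (lt0r_neq0 p_gt0)).
Qed.

(** This is where the exponent of the space enters: distinct basis vectors add
up with the power [p^-1] of their number. *)
Lemma lp_norm_sum_basis (I : eqType) (r : seq I) (pos : I -> int) (a : I -> R[i]) (b : R) :
  uniq (map pos r) -> (forall i, i \in r -> normc (a i) <= b) -> 0 <= b ->
  lp_norm p (\sum_(i <- r) a i *: lp_basis p1 (pos i)) <= b * (size r)%:R `^ p^-1.
Proof.
move=> ur ab b0; apply: lp_norm_le; first by rewrite mulr_ge0 ?powR_ge0.
rewrite powRM ?powR_ge0// -powRrM mulVf ?lt0r_neq0// powRr1//.
elim: r ur ab => [_ _|i r IH /= /andP[ir ur] ab].
  by rewrite big_nil lp_sum_norm lp_norm0 mulr0 (powR0 (lt0r_neq0 p_gt0)).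
rewrite big_cons (@lp_sum_disjoint (a i *: lp_basis p1 (pos i))); last first.
  move=> n; rewrite lp_valZ lp_basisE lp_val_sum; case: eqVneq => [->|]; last first.
    by rewrite mulr0; left.
  right; rewrite big1_seq// => j /andP[_ jr]; cbv beta; rewrite lp_valZ lp_basisE.
  case: eqVneq => [e|]; last by rewrite mulr0.
  by move: ir; rewrite e map_f.
rewrite lp_sum_basis -natr1 mulrDr mulr1 addrC EFinD leeD//; last first.
  rewrite lee_fin ge0_ler_powR ?nnegrE ?(ltW p_gt0) ?normc_ge0//.
  by apply: ab; rewrite inE eqxx.
by apply: IH => // j jr; apply: ab; rewrite inE jr orbT.
Qed.

Lemma lp_norm_basis n : lp_norm p (lp_basis p1 n) <= 1.
Proof.
apply: lp_norm_le => //.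
by have := lp_sum_basis 1 n; rewrite scale1r normc1 => ->.
Qed.

(** A bound on the norms of vectors that converge coordinatewise passes to
the limit, since only finitely many coordinates are tested at a time. It plays
the part of completeness below. *)
Lemma lp_sum_lim (x : int -> R[i]) (X : nat -> lp p1) (N : int -> nat) (b : R) :
  (forall n C, (N n <= C)%N -> X C n = x n) ->
  (forall C, lp_norm p (X C) <= b) -> (lp_sum p x <= (b `^ p)%:E)%E.
Proof.
move=> Xx Xb; apply: lp_sum_sup => r ur.
pose C := (\max_(n <- r) N n)%N.
rewrite -lee_fin; apply: le_trans (lp_sum_le (Xb C)).
apply: le_trans (le_lp_sum_seq _ ur); rewrite sumEFin lee_fin.
rewrite big_seq [leRHS]big_seq; apply: ler_sum => n nr.
by rewrite Xx// /C; apply: leq_bigmax_seq.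
Qed.

End lp_lemmas.

(** * Basic weak neighbourhoods *)

Section weak.
Context {K : numFieldType} (V : normedModType K).

(** A single bound on the sum of the deviations, rather than one bound for each
functional, is the form in which errors are estimated later. *)
Definition weak_basic (y : V) : set_system V :=
  [set A | exists (fs : seq (dual_space V)) (e : K), 0 < e /\
    forall z, \sum_(f <- fs) `|f z - f y| < e -> A z].

Lemma weak_basic_filter (y : V) : Filter (weak_basic y).
Proof.
split.
- by exists [::], 1; split.
- move=> A B [fs [e [e0 hA]]] [gs [d [d0 hB]]].
  have [c [c0 ce cd]] : exists c, [/\ 0 < c, c <= e & c <= d].
    by have [ed|/ltW de] := real_leP (gtr0_real e0) (gtr0_real d0); [exists e|exists d].
  exists (fs ++ gs), c; split=> // z; rewrite big_cat/= => h; split.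
    by apply: hA; apply: lt_le_trans ce; apply: le_lt_trans h; rewrite lerDl sumr_ge0.
  by apply: hB; apply: lt_le_trans cd; apply: le_lt_trans h; rewrite lerDr sumr_ge0.
- move=> A B AB [fs [e [e0 hA]]]; exists fs, e; split=> // z h.
  by apply: AB; apply: hA.
Qed.

(** The weak topology is a supremum, so [cvg_sup] reduces the inclusion of its
neighbourhoods in this filter to one functional at a time. *)
Lemma weak_open_basic (O : set V) (y : V) :
  @open (weak_topology V) O -> O y -> weak_basic y O.
Proof.
move=> oO Oy; have FF := weak_basic_filter y.
have : weak_basic y --> (y : weak_topology V).
  apply/cvg_sup => f A.
  rewrite (@nbhsE (initial_topology f)) => -[B [[C oC <-] Cy] BA].
  have : nbhs (f y) C by apply: open_nbhs_nbhs.
  move=> /nbhs_normP[e e0 eC]; exists [:: f], e; split=> // z.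
  rewrite big_seq1 => h; apply: BA; apply: eC.
  by rewrite /ball_/= distrC.
apply; exact: open_nbhs_nbhs.
Qed.

End weak.

(** * The weighted shift *)

Section shift.
Context {R : realType}.
Variables (p : R) (p1 : 1 <= p).
Implicit Types (x y : lp p1).
Let p_gt0 : 0 < p. Proof. exact: lt_le_trans p1. Qed.

Definition wshift_fun (x : int -> R[i]) (n : int) : R[i] :=
  (wt R n / wt R (n + 1))%:C * x (n + 1).

Lemma wt_ratio_le2 n : 0 <= wt R n / wt R (n + 1) <= 2.
Proof.
rewrite divr_ge0 ?(ltW (wt_gt0 _ _))//= ler_pdivrMr ?wt_gt0//.
exact: (wt_step R n).2.
Qed.

Lemma lp_sum_wshift (x : int -> R[i]) :
  (lp_sum p (wshift_fun x) <= (2 `^ p)%:E * lp_sum p x)%E.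
Proof.
rewrite -esumZ ?powR_ge0//; last by move=> n; rewrite lee_fin powR_ge0.
have <- : (\esum_(n in [set: int]) ((2 `^ p)%:E * ((normc (x (n + 1)) `^ p)%:E)) =
   \esum_(n in [set: int]) ((2 `^ p)%:E * ((normc (x n)) `^ p)%:E))%E.
  symmetry; apply: (@reindex_esum R int int setT setT (fun n => n + 1)) => //.
    split => //; first by move=> a b _ _; apply: addIr.
    by move=> n _; exists (n - 1) => //; rewrite subrK.
apply: le_esum => n _; rewrite -EFinM lee_fin -powRM//; last by rewrite normc_ge0.
have /andP[h0 h2] := wt_ratio_le2 n.
have nx := normc_ge0 (x (n + 1)).
rewrite /wshift_fun normcM normc_real_ge0//.
by apply: ge0_ler_powR; rewrite ?nnegrE ?(ltW p_gt0) ?ler_wpM2r//; apply: mulr_ge0.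
Qed.

Lemma wshift_subproof x : wshift_fun x \in lp_pred p1.
Proof.
rewrite inE /lp_pred/=; apply: le_lt_trans (lp_sum_wshift x) _.
by rewrite lp_sum_norm -EFinM ltry.
Qed.

Definition wshift x : lp p1 := Lp (wshift_subproof x).

Lemma wshiftE x n : wshift x n = (wt R n / wt R (n + 1))%:C * x (n + 1).
Proof. by []. Qed.

Lemma wshift_is_linear : linear wshift.
Proof.
move=> a x y; apply: lp_ext => n; rewrite lp_valD lp_valZ !wshiftE lp_valD lp_valZ.
by rewrite mulrDr !mulrA [_ * a]mulrC.
Qed.

HB.instance Definition _ :=
  GRing.isLinear.Build R[i] (lp p1) (lp p1) *:%R wshift wshift_is_linear.

Lemma wshift_norm x : lp_norm p (wshift x) <= 2 * lp_norm p x.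
Proof.
have n0 := lp_norm_ge0 p x.
apply: lp_norm_le; first by rewrite mulr_ge0.
apply: le_trans (lp_sum_wshift x) _.
by rewrite powRM// EFinM lp_sum_norm.
Qed.

Lemma wshift_continuous : continuous (wshift : lp p1 -> lp p1).
Proof.
apply/linear_bounded_continuous/linear_boundedP.
exists 2; split; first exact: realn.
move=> r r2 x; apply: (@le_trans _ _ (2 * `|x|)).
  rewrite !lp_normE -[2]/(2%:R) -(rmorph_nat (real_complex R)) -rmorphM lecR.
  exact: wshift_norm.
by rewrite ler_wpM2r// ltW.
Qed.

Lemma wshift_weighted : bilateral_weighted_shift
  (fun n => (wt R (n - 1) / wt R n)%:C) (wshift : {linear lp p1 -> lp p1}).
Proof.
split.
- move=> n; rewrite -[0]/(0%:C) (inj_eq (@complexI R)).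
  by rewrite mulf_neq0// ?invr_eq0 gt_eqF// wt_gt0.
- exists 2 => n; have := wt_ratio_le2 (n - 1); rewrite subrK => /andP[h0 h2].
  by rewrite normc_real_ge0.
- exact: wshift_continuous.
- move=> n; apply: lp_ext => m.
  rewrite wshiftE lp_valZ !lp_basisE -subr_eq opprK.
  by case: eqVneq => [<-|]; rewrite ?mulr0// addrK.
Qed.

Lemma iter_wshift m x n :
  iter m wshift x n = (wt R n / wt R (n + m))%:C * x (n + m).
Proof.
elim: m n => [|m IH] n.
  by rewrite addr0 divff ?gt_eqF ?wt_gt0// mul1r.
rewrite iterS wshiftE IH mulrA -rmorphM/= -addrA.
rewrite (_ : 1 + m%:Z = m.+1)//; congr (_%:C * _).
rewrite mulrA divfK// gt_eqF ?wt_gt0//.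
Qed.

End shift.

(** * Failure of supercyclicity *)

Section nonsuper.
Context {R : realType}.
Variables (p : R) (p1 : 1 <= p).

(** Both sides are the product of the same two coordinates of [x], and the
remaining factor on the left is [wt d * wt (- d) = 1] for [d = n - m]. *)
Lemma iter_wshift_cross m n (x : lp p1) :
  iter m (@wshift R p p1) x (n%:Z - m%:Z) * iter n (@wshift R p p1) x (m%:Z - n%:Z) =
  iter m (@wshift R p p1) x 0 * iter n (@wshift R p p1) x 0.
Proof.
rewrite !iter_wshift !subrK !add0r wt0 mulrACA [RHS]mulrACA [x n * _]mulrC.
congr (_ * _); rewrite -!rmorphM/=; congr (_%:C).
rewrite mulrACA -(opprB n%:Z m%:Z) [X in X * _]mulrC wtNM [RHS]mulrACA mul1r.
by rewrite [(wt R m)^-1 * _]mulrC mulr1 mul1r.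
Qed.

Lemma lp_dense_approx (S : set (lp p1)) (y : lp p1) (e : R) : dense S -> 0 < e ->
  exists2 z, S z & forall m, normc (y m - z m) < e.
Proof.
move=> dS e0; have e0C : 0 < e%:C by rewrite ltcR.
have [||z [yz Sz]] := dS (ball y e%:C); first by exists y; exact: ballxx.
  exact: ball_open.
exists z => // m; apply: le_lt_trans (normc_le_lp_norm (y - z) m) _.
by move: yz; rewrite -ball_normE /ball_/= lp_normE ltcR.
Qed.

(** The targets [e_0] and [e_0 + e_1 / 4] have different ratios of their first
two coordinates, which forces the two approximating powers to be different;
then [iter_wshift_cross] gives the contradiction. *)
Lemma wshift_not_supercyclic : ~ supercyclic (@wshift R p p1).
Proof.
move=> [x dx].
have e0 : 0 < 16^-1 :> R by rewrite invr_gt0.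
have [_ [l1 _ [n1 _ <-]] h1] := lp_dense_approx (lp_basis p1 0) dx e0.
have [_ [l2 _ [n2 _ <-]] h2] :=
  lp_dense_approx (lp_basis p1 0 + (4^-1)%:C *: lp_basis p1 1) dx e0.
set a := l1 *: _ in h1; set b := l2 *: _ in h2.
have near (z t : R[i]) (e : R) : normc (t - z) < e ->
    normc t - e < normc z < normc t + e.
  move=> te; have h := le_normcD (t - z) z; rewrite subrK in h.
  have h' := le_normcD (z - t) t; rewrite subrK -(normcN (z - t)) opprB in h'.
  by apply/andP; split; lra.
have q_eq : normc (4^-1)%:C = 4^-1 :> R by rewrite normc_real_ge0// invr_ge0.
have /andP[a0 _] : 1 - 16^-1 < normc (a 0) < 1 + 16^-1.
  by have := near _ _ _ (h1 0); rewrite lp_basisE eqxx normc1.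
have {h1}am m : m != 0 -> normc (a m) < 16^-1.
  move=> /negPf m0; have := near _ _ _ (h1 m).
  by rewrite lp_basisE m0 mulr0n normc0 !add0r => /andP[].
have /andP[b0 b0'] : 1 - 16^-1 < normc (b 0) < 1 + 16^-1.
  have := near _ _ _ (h2 0); rewrite lp_valD lp_valZ !lp_basisE eqxx.
  by rewrite mulr0 addr0 normc1.
have /andP[b1 _] : 4^-1 - 16^-1 < normc (b 1) < 4^-1 + 16^-1.
  have := near _ _ _ (h2 1); rewrite lp_valD lp_valZ !lp_basisE eqxx.
  by rewrite mulr1 add0r q_eq.
have {h2}bm m : m != 0 -> normc (b m) < 4^-1 + 16^-1.
  move=> /negPf m0; have := near _ _ _ (h2 m).
  rewrite lp_valD lp_valZ !lp_basisE m0 mulr0n add0r => /andP[_ h]; apply: lt_le_trans h _.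
  rewrite lerD2r normcM q_eq; case: eqVneq => _; first by rewrite normc1 mulr1.
  by rewrite normc0 mulr0 invr_ge0.
(* The numerical margins are 1/16 * 17/16 < 15/16 * 3/16 for equal powers and
   1/16 * 5/16 < (15/16)^2 for different ones. *)
have [n12|n12] := eqVneq n1 n2.
  have : normc (a 1) * normc (b 0) = normc (a 0) * normc (b 1).
    rewrite -!normcM /a /b n12 !lp_valZ; congr normc; ring.
  have a1 := am 1 isT; have := normc_ge0 (a 1); nra.
have d0 : n2%:Z - n1%:Z != 0 by rewrite subr_eq0 eqz_nat eq_sym.
have d0' : n1%:Z - n2%:Z != 0 by rewrite subr_eq0 eqz_nat.
have : normc (a (n2%:Z - n1%:Z)) * normc (b (n1%:Z - n2%:Z)) = normc (a 0) * normc (b 0).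
  rewrite -!normcM /a /b !lp_valZ mulrACA iter_wshift_cross.
  by congr normc; ring.
have := am _ d0; have := bm _ d0'.
have := normc_ge0 (a (n2%:Z - n1%:Z)); have := normc_ge0 (b (n1%:Z - n2%:Z)); nra.
Qed.
End nonsuper.

(** * Blocks of indices *)

Definition block (c : nat) : seq nat := index_iota (4 ^ c) (4 ^ c.+1).

Lemma scale_block c j : j \in block c -> scale j = c.
Proof. by rewrite mem_index_iota => h; apply: trunc_log_eq. Qed.

Lemma size_block c : (4 ^ c <= size (block c) <= 4 * 4 ^ c)%N.
Proof. rewrite size_iota expnS; lia. Qed.

Lemma block_uniq c : uniq (block c). Proof. exact: iota_uniq. Qed.

Lemma block_gt c j : j \in block c -> (c < j)%N.
Proof. by rewrite mem_index_iota => /andP[h _]; apply: leq_trans (ltn_exp4 c) h. Qed.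

(** A finite list of positions and rational complex coefficients; the type is
countable, so that the patterns can be enumerated. *)
Definition pattern : Type := seq (int * (rat * rat)).

Section hyper.
Context {R : realType}.
Variables (p : R) (p1 : 1 <= p) (p2 : 2 < p).
Implicit Types (x y : lp p1) (s : pattern).
Let p_gt0 : 0 < p. Proof. exact: lt_le_trans p1. Qed.
Local Notation T := (@wshift R p p1).

Definition weighted_basis (a : int) : lp p1 := (wt R a)%:C *: lp_basis p1 a.
Local Notation E := weighted_basis.

Lemma weighted_basisE a n : E a n = (wt R a)%:C * (n == a)%:R.
Proof. by rewrite lp_valZ lp_basisE. Qed.

Lemma iter_wshift_basis m a : iter m T (E a) = E (a - m%:Z).
Proof.
apply: lp_ext => n; rewrite iter_wshift !weighted_basisE -subr_eq opprK.
case: eqVneq => [<-|_]; last by rewrite !mulr0.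
by rewrite mulrA -rmorphM/= divfK ?gt_eqF ?wt_gt0// addrK.
Qed.

Lemma iter_wshift_sum m I (r : seq I) (F : I -> lp p1) :
  iter m T (\sum_(i <- r) F i) = \sum_(i <- r) iter m T (F i).
Proof. by elim: m => // m IH; rewrite iterS IH raddf_sum. Qed.

Lemma iter_wshiftZ m l x : iter m T (l *: x) = l *: iter m T x.
Proof. by elim: m => // m IH; rewrite iterS IH linearZ. Qed.

(** * Patterns and their schedule *)

Definition rat_complex (q : rat * rat) : R[i] := ratr q.1 +i* ratr q.2.

(** Superposition of the vectors [F i] with the coefficients prescribed by the
pattern; [F i] is, for instance, a sum of copies of [E i] translated to all
centres of a block. *)
Definition pattern_sum s (F : int -> lp p1) : lp p1 :=
  \sum_(t <- s) rat_complex t.2 *: F t.1.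

Lemma pattern_sumD s F G :
  pattern_sum s (fun i => F i + G i) = pattern_sum s F + pattern_sum s G.
Proof. by rewrite -big_split; apply: eq_bigr => t _; rewrite scalerDr. Qed.

Lemma pattern_sum_sum s I (r : seq I) (F : I -> int -> lp p1) :
  pattern_sum s (fun a => \sum_(i <- r) F i a) = \sum_(i <- r) pattern_sum s (F i).
Proof. by rewrite exchange_big; apply: eq_bigr => t _; rewrite scaler_sumr. Qed.

Lemma pattern_sumZ s l F : pattern_sum s (fun a => l *: F a) = l *: pattern_sum s F.
Proof.
by rewrite scaler_sumr; apply: eq_bigr => t _; rewrite !scalerA mulrC.
Qed.

Lemma iter_wshift_pattern m s F :
  iter m T (pattern_sum s F) = pattern_sum s (fun a => iter m T (F a)).
Proof. by rewrite iter_wshift_sum; apply: eq_bigr => t _; rewrite iter_wshiftZ. Qed.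

Definition target s : lp p1 := pattern_sum s E.

(** Bounds the coefficients of any translate of the pattern relative to the
weight at its centre, since the weight changes by at most [2 ^ |i|] over a
distance [|i|]. *)
Definition cost s : R := \sum_(t <- s) normc (rat_complex t.2) * 2 ^+ `|t.1|%N.

(** The norm of a sum of [4 ^ c] disjointly supported vectors of norm [2 ^- c] is
[growth ^ c]; the hypothesis [2 < p] says that [growth < 1]. *)
Definition growth : R := 4 `^ p^-1 / 2.

Lemma growth_gt0 : 0 < growth. Proof. by rewrite divr_gt0 ?powR_gt0. Qed.

Lemma growth_lt1 : growth < 1.
Proof.
rewrite ltr_pdivrMr// mul1r.
have <- : 4 `^ 2^-1 = 2 :> R.
  by rewrite powR12_sqrt// (_ : 4 = 2 ^+ 2) ?sqrtr_sqr ?ger0_norm//; ring.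
rewrite /powR (gt_eqF (ltr0n _ 4)) ltr_expR ltr_pM2r ?ln_gt0 ?ltr1n//.
by rewrite ltf_pV2 ?posrE.
Qed.

(** Half of the decay of [growth ^ c] is spent on the cost of the patterns and the
other half makes the series over the blocks converge. *)
Definition ratio : R := Num.sqrt growth.

Lemma ratio_gt0 : 0 < ratio. Proof. by rewrite sqrtr_gt0 growth_gt0. Qed.
Lemma ratio_lt1 : ratio < 1.
Proof. by rewrite -sqrtr1 ltr_sqrt ?growth_lt1. Qed.
Lemma ratio_sqr : ratio ^+ 2 = growth. Proof. by rewrite sqr_sqrtr// ltW// growth_gt0. Qed.

Lemma geometric_le (C : nat) : \sum_(c < C) ratio ^+ c <= (1 - ratio)^-1.
Proof.
have h : 0 < 1 - ratio by rewrite subr_gt0 ratio_lt1.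
rewrite -[leRHS]mul1r ler_pdivlMr// mulrC -(opprB ratio) mulNr -subrX1 opprB.
by rewrite gerBl exprn_ge0// ltW// ratio_gt0.
Qed.

(** The first condition confines the effect of block [c] to coordinates larger than
[c], the second keeps the norms summable. Both hold for a fixed pattern once [c] is large. *)
Definition admissible (c : nat) s : bool :=
  all (fun t => `|t.1| <= c)%N s && (cost s * ratio ^+ c <= 1).

(** Decoding the exponent of 2 in [c] makes every code occur at arbitrarily large
[c]; patterns that come too early are replaced by the empty one. *)
Definition schedule (c : nat) : pattern :=
  let s := odflt [::] (unpickle (logn 2 c) : option pattern) in
  if admissible c s then s else [::].

Lemma schedule_admissible c : admissible c (schedule c).
Proof.
rewrite /schedule; case: ifP => // _.
by rewrite /admissible /= /cost big_nil mul0r ler01.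
Qed.

Lemma cost_ge0 s : 0 <= cost s.
Proof. by apply: sumr_ge0 => t _; rewrite mulr_ge0 ?normc_ge0 ?exprn_ge0. Qed.

Lemma schedule_recurs s N : exists2 c, (N <= c)%N & schedule c = s.
Proof.
have [M hM] : exists M, forall c, (M <= c)%N -> admissible c s.
  have [||N1 hN1] := @expr_small R ratio (cost s + 1)^-1.
  - by rewrite ltW ?ratio_gt0 ?ratio_lt1.
  - by rewrite invr_gt0 ltr_wpDl ?cost_ge0.
  exists (N1 + \max_(t <- s) `|t.1|)%N => c hc; apply/andP; split.
    apply/allP => t ts; apply: leq_trans (leq_trans (leq_addl _ _) hc).
    exact: (@leq_bigmax_seq _ _ xpredT (fun t : int * (rat * rat) => `|t.1|%N)).
  have /ltW h : ratio ^+ c < (cost s + 1)^-1 by apply: hN1; lia.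
  apply: (le_trans (ler_wpM2l (cost_ge0 s) h)).
  by rewrite ler_pdivrMr ?mul1r ?lerDl// ltr_wpDl ?cost_ge0.
(* The odd factor leaves the exponent of 2 equal to the code of s. *)
exists (2 ^ pickle s * (N + M).*2.+1)%N.
  rewrite (leq_trans _ (leq_pmull _ _)) ?expn_gt0//; lia.
have le_c : (M <= 2 ^ pickle s * (N + M).*2.+1)%N.
  rewrite (leq_trans _ (leq_pmull _ _)) ?expn_gt0//; lia.
rewrite /schedule lognM ?expn_gt0// pfactorK// logn_coprime; last first.
  by rewrite coprime2n/= odd_double.
by rewrite addn0 pickleK /= hM.
Qed.

(** * Superpositions of patterns *)

(** The common estimate behind the vector itself (centres [4 ^ j]) and the errors
along its orbit (centres [4 ^ j - 4 ^ k]). For a fixed position of the pattern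
of block [c], the translates to all the centres are distinct basis vectors; the
triangle inequality over positions and blocks then costs [cost] and a geometric
series. *)
Lemma superposition_norm (I : eqType) (r : nat -> seq I) (pos : I -> int)
    (th : I -> R[i]) (K : R) (M : nat) (C : nat) :
  (forall c, uniq (map pos (r c))) ->
  (forall c i, i \in r c -> wt R (pos i) <= K / 2 ^+ c) ->
  (forall i, normc (th i) <= 1) ->
  (forall c, (size (r c) <= M * 4 ^ c)%N) -> 0 <= K ->
  lp_norm p (\sum_(c < C) pattern_sum (schedule c)
     (fun a => \sum_(i <- r c) th i *: E (pos i + a)))
  <= K * M%:R `^ p^-1 / (1 - ratio).
Proof.
move=> ur wr th1 sr K0; have pV : 0 <= p^-1 by rewrite invr_ge0 ltW.
have KM0 : 0 <= K * M%:R `^ p^-1 by rewrite mulr_ge0 ?powR_ge0.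
apply: le_trans (lp_norm_sum _ _) _.
apply: (@le_trans _ _ (\sum_(c < C) (K * M%:R `^ p^-1) * ratio ^+ c)); last first.
  by rewrite -mulr_sumr ler_wpM2l// geometric_le.
apply: ler_sum => c _; apply: le_trans (lp_norm_sum _ _) _.
have /andP[_ hc] := schedule_admissible c.
apply: (@le_trans _ _ (cost (schedule c) * (K * M%:R `^ p^-1 * growth ^+ c))).
  rewrite /cost mulr_suml; apply: ler_sum => t _.
  rewrite lp_normZ -[leRHS]mulrA ler_wpM2l ?normc_ge0//.
  under eq_bigr do rewrite scalerA.
  have := @lp_norm_sum_basis R p p1 I (r c) (fun i => pos i + t.1)
     (fun i => th i * (wt R (pos i + t.1))%:C) (2 ^+ `|t.1|%N * (K / 2 ^+ c)).
  move=> h; apply: le_trans (h _ _ _) _.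
  - by rewrite (map_comp (fun a => a + t.1)) map_inj_uniq//; exact: addIr.
  - move=> i ir; rewrite normcM normc_real_ge0 ?(ltW (wt_gt0 _ _))//.
    apply: (@le_trans _ _ (wt R (pos i + t.1))).
      by rewrite ler_piMl// ltW// wt_gt0.
    by apply: (le_trans (wt_shift _ _ _)); rewrite ler_wpM2l ?exprn_ge0// wr.
  - by rewrite mulr_ge0 ?exprn_ge0// divr_ge0// exprn_ge0.
  rewrite -!mulrA ler_wpM2l ?exprn_ge0// ler_wpM2l//.
  apply: (@le_trans _ _ ((2 ^+ c)^-1 * (M * 4 ^ c)%:R `^ p^-1)).
    rewrite ler_wpM2l ?invr_ge0 ?exprn_ge0// ge0_ler_powR ?nnegrE ?ler0n//.
    by rewrite ler_nat.
  rewrite natrM powRM ?ler0n// mulrCA ler_wpM2l ?powR_ge0//.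
  by rewrite natrX powR_exprn// /growth expr_div_n mulrC.
(* One factor ratio ^+ c absorbs the cost, the other one is summed over c. *)
rewrite -ratio_sqr exprAC expr2 mulrCA ler_wpM2l// mulrA.
by rewrite ler_piMl// exprn_ge0// ltW// ratio_gt0.
Qed.

(** * The weakly hypercyclic vector *)

Definition partial_vector (C : nat) : lp p1 :=
  \sum_(c < C) pattern_sum (schedule c)
    (fun a => \sum_(j <- block c) E ((4 ^ j)%N%:Z + a)).

Lemma partial_vectorS C : partial_vector C.+1 = partial_vector C +
  pattern_sum (schedule C) (fun a => \sum_(j <- block C) E ((4 ^ j)%N%:Z + a)).
Proof. exact: big_ord_recr. Qed.

(** The patterns of block [c] live in a neighbourhood of radius [c] of points
larger than [2 * c], so block [c] only affects coordinates larger than [c]. *)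
Lemma partial_vector_stable n C : (`|n|%N < C)%N ->
  partial_vector C n = partial_vector `|n|%N.+1 n.
Proof.
move=> nC; rewrite -(subnKC nC); elim: (C - _)%N => [|k IH]; first by rewrite addn0.
rewrite addnS -IH partial_vectorS lp_valD [X in _ + X](_ : _ = 0) ?addr0//.
rewrite lp_val_sum big1_seq// => t /andP[_ ts]; cbv beta.
rewrite lp_valZ lp_val_sum big1_seq ?mulr0// => j /andP[_ jc]; cbv beta.
rewrite weighted_basisE; case: eqVneq => [e|]; last by rewrite mulr0.
have /andP[/allP/(_ _ ts) /= ac _] := schedule_admissible (`|n|.+1 + k).
have := block_gt jc; have := ltn_exp4 j; have := leq_exp4S (block_gt jc).
have := ltn_exp4 (`|n|.+1 + k); lia.
Qed.

Definition vector_coord (n : int) : R[i] := partial_vector `|n|%N.+1 n.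

Lemma partial_vector_norm C :
  lp_norm p (partial_vector C) <= 1 * 4%N%:R `^ p^-1 / (1 - ratio).
Proof.
have := @superposition_norm nat block (fun j => (4 ^ j)%N) (fun=> 1) 1 4 C.
rewrite /partial_vector => h.
rewrite (eq_bigr (fun c : 'I_C => pattern_sum (schedule c)
  (fun a => \sum_(j <- block c) 1 *: E ((4 ^ j)%N%:Z + a)))); last first.
  move=> c _; congr (pattern_sum _ _); apply: funext => a.
  by apply: eq_bigr => j _; rewrite scale1r.
apply: h => //.
- move=> c; rewrite map_inj_uniq ?block_uniq// => i j [] /eqP.
  by rewrite eqn_exp2l// => /eqP.
- by move=> c j jc; rewrite (le_trans (wt_exp _ _))// (scale_block jc) mul1r.
- by move=> _; rewrite normc1.
- by move=> c; have /andP[] := size_block c.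
Qed.

Lemma vector_coord_subproof : vector_coord \in lp_pred p1.
Proof.
rewrite inE /lp_pred/=.
apply: le_lt_trans (lp_sum_lim (N := fun n => `|n|%N.+1) _ partial_vector_norm) (ltry _).
by move=> n C nC; exact: partial_vector_stable.
Qed.

Definition hypercyclic_vector : lp p1 := Lp vector_coord_subproof.
Local Notation h := hypercyclic_vector.

Lemma hypercyclic_vectorE n C : (`|n|%N < C)%N -> partial_vector C n = h n.
Proof. exact: partial_vector_stable. Qed.

(** For [k] in a block, what remains of [iter (4 ^ k) T h] once the copy formerly
centred at [4 ^ k], which the shift has moved to the origin, is subtracted. *)
Definition error k : lp p1 := iter (4 ^ k) T h - target (schedule (scale k)).

Definition partial_error C k : lp p1 :=
  iter (4 ^ k) T (partial_vector C) - target (schedule (scale k)).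

(** The terms with [j = k] occur only in block [b], where their shifts add up to
the target of its pattern. *)
Lemma partial_errorE C b k : (b < C)%N -> k \in block b ->
  partial_error C k = \sum_(c < C) pattern_sum (schedule c)
    (fun a => \sum_(j <- block c | j != k) E ((4 ^ j)%N%:Z - (4 ^ k)%N%:Z + a)).
Proof.
move=> bC kb; rewrite /partial_error (scale_block kb) iter_wshift_sum.
apply/eqP; rewrite subr_eq; apply/eqP.
have -> : target (schedule b) = \sum_(c < C) pattern_sum (schedule c)
    (fun a => \sum_(j <- block c | j == k) E a).
  rewrite (bigD1 (Ordinal bC))//= [X in _ + X]big1 ?addr0.
    congr (pattern_sum _ _); apply: funext => a.
    by rewrite -big_filter filter_pred1_uniq ?block_uniq// big_seq1.
  move=> c cb; rewrite /pattern_sum big1// => t _.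
  rewrite big1_seq ?scaler0// => j /andP[/eqP-> kc].
  move: cb; rewrite -val_eqE /= -(scale_block kb).
  by rewrite (scale_block kc) eqxx.
rewrite -big_split/=; apply: eq_bigr => c _; rewrite -pattern_sumD iter_wshift_pattern.
congr (pattern_sum _ _); apply: funext => a; rewrite iter_wshift_sum.
rewrite (bigID (fun j => j == k))/= addrC; congr (_ + _).
  by apply: eq_bigr => j _; rewrite iter_wshift_basis addrAC.
by apply: eq_bigr => j /eqP->; rewrite iter_wshift_basis addrAC subrr add0r.
Qed.

Definition block_pairs b c : seq (nat * nat) :=
  [seq jk <- [seq (j, k) | j <- block c, k <- block b] | jk.1 != jk.2].

Lemma block_pairsP b c jk : jk \in block_pairs b c ->
  [/\ jk.1 != jk.2, jk.1 \in block c & jk.2 \in block b].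
Proof.
by rewrite mem_filter => /andP[njk /allpairsP[[j k] /= [jc kb e]]]; rewrite e in njk *.
Qed.

Definition block_bound (b : nat) : R :=
  2 * 2 ^+ b * (16 * 4 ^ b)%N%:R `^ p^-1 / (1 - ratio).

(** Distinctness of the centres is [exp4_sum_inj]. The excluded pairs [j = k]
are those for which the centre would be 0. *)
Lemma partial_error_norm C b (th : nat -> R[i]) : (b < C)%N ->
  (forall k, normc (th k) <= 1) ->
  lp_norm p (\sum_(k <- block b) th k *: partial_error C k) <=
  block_bound b.
Proof.
move=> bC th1; rewrite /block_bound.
have -> : \sum_(k <- block b) th k *: partial_error C k =
  \sum_(c < C) pattern_sum (schedule c) (fun a => \sum_(jk <- block_pairs b c)
    th jk.2 *: E ((4 ^ jk.1)%N%:Z - (4 ^ jk.2)%N%:Z + a)).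
  rewrite big_seq (eq_bigr (fun k => \sum_(c < C) pattern_sum (schedule c)
    (fun a => \sum_(j <- block c | j != k)
      th k *: E ((4 ^ j)%N%:Z - (4 ^ k)%N%:Z + a)))); last first.
    move=> k kb; rewrite (partial_errorE bC kb) scaler_sumr.
    apply: eq_bigr => c _; rewrite -pattern_sumZ; congr (pattern_sum _ _).
    by apply: funext => a; rewrite scaler_sumr.
  rewrite -big_seq exchange_big/=; apply: eq_bigr => c _.
  rewrite -pattern_sum_sum; congr (pattern_sum _ _); apply: funext => a.
  rewrite [RHS]big_filter [RHS]big_mkcond big_allpairs/= [RHS]exchange_big/=.
  by apply: eq_bigr => k _; rewrite [LHS]big_mkcond.
apply: superposition_norm => //.
- move=> c; rewrite map_inj_in_uniq.
    by rewrite filter_uniq// allpairs_uniq ?block_uniq// => -[? ?] [? ?].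
  move=> [j k] [j' k'] /block_pairsP[/= njk _ _] /block_pairsP[/= njk' _ _] e.
  have /exp4_sum_inj : (4 ^ j + 4 ^ k' = 4 ^ j' + 4 ^ k)%N by lia.
  by case=> -[e1 e2]; [rewrite e1 e2|rewrite e1 eqxx in njk].
- move=> c jk /block_pairsP[njk jc kb]; apply: le_trans (wt_gap _ njk) _.
  by rewrite (scale_block jc) (scale_block kb).
- move=> c; rewrite size_filter (leq_trans (count_size _ _))// size_allpairs.
  have /andP[_ h1] := size_block c; have /andP[_ h2] := size_block b.
  by apply: leq_trans (leq_mul h1 h2) _; lia.
Qed.

Lemma iter_wshift_local m x y n : x (n + m%:Z) = y (n + m%:Z) ->
  iter m T x n = iter m T y n.
Proof. by rewrite !iter_wshift => ->. Qed.

(** [partial_error_norm] in the limit: the coordinate [n] of the errors of block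
[b] only involves coordinates of [h] up to [n + 4 ^ k] with [k < 4 ^ b.+1]. *)
Lemma error_norm b (th : nat -> R[i]) : (forall k, normc (th k) <= 1) ->
  lp_norm p (\sum_(k <- block b) th k *: error k) <=
  block_bound b.
Proof.
move=> th1; apply: lp_norm_le.
  by rewrite divr_ge0 ?mulr_ge0 ?powR_ge0 ?exprn_ge0// subr_ge0 ltW// ratio_lt1.
(* b.+1 + C ensures that block b is part of the approximating vector. *)
apply: (lp_sum_lim (X := fun C => \sum_(k <- block b) th k *: partial_error (b.+1 + C) k)
  (N := fun n => (`|n| + 4 ^ 4 ^ b.+1)%N)); last first.
  by move=> C; apply: partial_error_norm => //; rewrite leq_addr.
move=> n C nC; rewrite !lp_val_sum big_seq [RHS]big_seq; apply: eq_bigr => k kb.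
rewrite !lp_valZ !lp_valB; congr (_ * (_ - _)); apply: iter_wshift_local.
apply: hypercyclic_vectorE.
have : (4 ^ k < 4 ^ 4 ^ b.+1)%N.
  by rewrite ltn_exp2l//; move: kb; rewrite mem_index_iota => /andP[].
lia.
Qed.

(** * Averages of functionals over a block *)

Lemma dual_bound (f : dual_space (lp p1)) :
  exists2 M : R, 0 <= M & forall x, normc (f x) <= M * lp_norm p x.
Proof.
have /linear_bounded_continuous/linear_boundedP/pinfty_ex_gt0[M M0 hM] :=
  @functional_continuous _ _ f.
have MR : M = (complex.Re M)%:C by rewrite RRe_real// gtr0_real.
exists (complex.Re M); first by rewrite -lecR -MR ltW.
move=> x; have := hM x; rewrite lp_normE MR -rmorphM.
by rewrite -[`|f x|]/((normc (f x))%:C) lecR.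
Qed.

Lemma duals_bound (fs : seq (dual_space (lp p1))) :
  exists2 M : R, 0 <= M & forall x, \sum_(f <- fs) normc (f x) <= M * lp_norm p x.
Proof.
elim: fs => [|f fs [M M0 hM]]; first by exists 0 => // x; rewrite big_nil mul0r.
have [N N0 hN] := dual_bound f; exists (N + M); first exact: addr_ge0.
by move=> x; rewrite big_cons mulrDl lerD.
Qed.

Lemma block_boundE b : block_bound b = block_bound 0 * (4 * growth) ^+ b.
Proof.
rewrite /block_bound expr0 mulr1 expn0 muln1 natrM powRM// natrX powR_exprn//.
have -> : 4 * growth = 2 * 4 `^ p^-1 by rewrite /growth; field.
rewrite exprMn; ring.
Qed.

(** Weighting the errors by the phases of [f] turns the sum of moduli into the
value of [f] at one combination of errors. *)
Lemma functional_block (f : dual_space (lp p1)) :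
  exists2 M : R, 0 <= M & forall b,
    \sum_(k <- block b) normc (f (error k)) <= M * (4 * growth) ^+ b.
Proof.
have [M M0 hM] := dual_bound f.
have bb0 : 0 <= block_bound 0.
  by rewrite divr_ge0 ?mulr_ge0 ?powR_ge0 ?exprn_ge0// subr_ge0 ltW// ratio_lt1.
exists (M * block_bound 0); first exact: mulr_ge0.
have [th th1 thf] : exists2 th : nat -> R[i], (forall k, normc (th k) <= 1) &
    forall k, th k * f (error k) = (normc (f (error k)))%:C.
  have /choice[th hth] k : exists u, normc u <= 1 /\
      u * f (error k) = (normc (f (error k)))%:C.
    by have [u u1 uf] := normc_phase (f (error k)); exists u.
  by exists th => k; have [] := hth k.
move=> b; rewrite -mulrA -block_boundE.
apply: le_trans (ler_wpM2l M0 (error_norm b th1)).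
apply: le_trans (hM _); rewrite linear_sum/=.
under [X in normc X]eq_bigr do rewrite linearZ/=.
rewrite (eq_bigr (fun k => (normc (f (error k)))%:C)); last by move=> k _; exact: thf.
by rewrite -rmorph_sum normc_real_ge0// sumr_ge0// => k _; exact: normc_ge0.
Qed.

Lemma functionals_block (fs : seq (dual_space (lp p1))) :
  exists2 M : R, 0 <= M & forall b,
    \sum_(k <- block b) \sum_(f <- fs) normc (f (error k)) <= M * (4 * growth) ^+ b.
Proof.
elim: fs => [|f fs [M M0 hM]].
  by exists 0 => // b; rewrite mul0r big1// => k _; rewrite big_nil.
have [N N0 hN] := functional_block f; exists (N + M); first exact: addr_ge0.
move=> b; under eq_bigr do rewrite big_cons.
by rewrite big_split/= mulrDl lerD.
Qed.

(** Otherwise the sum over block [b] would be at least [4 ^ b * e], whereas it is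
bounded by a multiple of [4 ^ b * growth ^ b]. *)
Lemma error_weakly_small (fs : seq (dual_space (lp p1))) (e : R) : 0 < e ->
  exists N, forall b, (N <= b)%N ->
    exists2 k, k \in block b & \sum_(f <- fs) normc (f (error k)) < e.
Proof.
move=> e0; have [M M0 hM] := functionals_block fs.
have M1 : 0 < M + 1 by rewrite ltr_wpDl.
have [||N hN] := @expr_small R growth (e / (M + 1)).
- by rewrite ltW ?growth_gt0 ?growth_lt1.
- by rewrite divr_gt0.
exists N => b /hN; rewrite ltr_pdivlMr// => gb.
apply: contrapT => no; have big_e k : k \in block b ->
    e <= \sum_(f <- fs) normc (f (error k)).
  by move=> kb; rewrite leNgt; apply/negP => lt_e; apply: no; exists k.
have : (4 ^ b)%N%:R * e <= M * (4 * growth) ^+ b.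
  apply: le_trans (hM b).
  apply: (@le_trans _ _ (\sum_(k <- block b) e)).
    rewrite big_const_seq count_predT iter_addr_0 -[leRHS]mulr_natl.
    by rewrite ler_wpM2r ?(ltW e0)// ler_nat; have /andP[] := size_block b.
  by rewrite big_seq [leRHS]big_seq; apply: ler_sum.
rewrite natrX exprMn mulrCA ler_pM2l ?exprn_gt0// leNgt; apply/negP/negPn.
apply: le_lt_trans gb; rewrite [leRHS]mulrC.
by rewrite ler_wpM2r ?exprn_ge0 ?(ltW growth_gt0)// lerDl.
Qed.

(** * Density of the targets *)

Lemma rat_complex_approx (z : R[i]) (v e : R) : 0 < v -> 0 < e ->
  exists q, normc (z - rat_complex q * v%:C) < e.
Proof.
move=> v0 e0; case: z => a b.
have approx c : exists q : rat, `|c - ratr q * v| < e / 2.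
  have [|q h] := @rat_approx R (c / v) (e / 2 / v); first by rewrite !divr_gt0.
  exists q; rewrite (_ : c - _ = (c / v - ratr q) * v).
    by rewrite normrM (gtr0_norm v0) -ltr_pdivlMr.
  by rewrite mulrBl divfK ?gt_eqF.
have [[q1 h1] [q2 h2]] := (approx a, approx b).
exists (q1, q2).
have -> : a +i* b - rat_complex (q1, q2) * v%:C =
    (a - ratr q1 * v) +i* (b - ratr q2 * v).
  apply/eqP; rewrite eq_complex; apply/andP; split; apply/eqP => /=; ring.
apply: le_lt_trans (normc_le_abs _ _) _; lra.
Qed.

(** The part of [y] outside a finite set of coordinates carries the difference of
[lp_sum y] and a finite partial sum. *)
Lemma truncation (y : lp p1) (e : R) : 0 < e ->
  exists2 r : seq int, uniq r &
    lp_norm p (y - \sum_(i <- r) y i *: lp_basis p1 i) < e.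
Proof.
move=> e0; have ep : 0 < e `^ p by rewrite powR_gt0.
have fy : lp_sum p y \is a fin_num by rewrite lp_sum_norm.
have [_ [A [fA _] <-]] := ub_ereal_sup_adherent ep fy.
rewrite fsbig_finite//=; set r := finmap.enum_fset _ => hr.
have ur : uniq r by exact: finmap.fset_uniq.
exists r => //; set t : lp p1 := \sum_(i <- r) _.
have ti n : t n = if n \in r then y n else 0.
  rewrite lp_val_sum; case: ifPn => nr.
    rewrite (bigD1_seq n nr ur) big1_seq ?addr0.
      by rewrite lp_valZ lp_basisE eqxx mulr1 [LHS]addr0.
    move=> i /andP[/negPf i_n _]; cbv beta; rewrite lp_valZ lp_basisE eq_sym i_n.
    by rewrite mulr0.
  rewrite big1_seq// => i /andP[_ ir]; cbv beta; rewrite lp_valZ lp_basisE.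
  by case: eqVneq => [ni|]; rewrite ?mulr0//; rewrite ni ir in nr.
have e1 := @lp_sum_disjoint R p p1 t (y - t); rewrite [t + _]addrC subrK in e1.
have {}e1 : lp_sum p y = (lp_sum p t + lp_sum p (y - t)%R)%E.
  apply: e1 => n; rewrite lp_valB ti.
  by case: ifP; [right; rewrite subrr|left].
have : (\sum_(i <- r) (normc (y i) `^ p)%:E <= lp_sum p t)%E.
  rewrite (eq_big_seq (fun i => (normc (t i) `^ p)%:E)); first exact: le_lp_sum_seq.
  by move=> i ir; rewrite ti ir.
move: hr; rewrite -[ereal_sup _]/(lp_sum p y) e1 !lp_sum_norm sumEFin.
rewrite -!EFinD lte_fin lee_fin => h1 h2.
have := lt_le_trans h1 h2; rewrite -addrA gtrDl subr_lt0.
apply: contraTT; rewrite -!leNgt => h.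
by rewrite ge0_ler_powR ?nnegrE ?lp_norm_ge0 ?(ltW p_gt0) ?(ltW e0).
Qed.

Lemma target_dense (y : lp p1) (e : R) : 0 < e ->
  exists s, lp_norm p (y - target s) < e.
Proof.
move=> e0; have e2 : 0 < e / 2 by rewrite divr_gt0.
have [r _ hr] := truncation y e2.
have d0 : 0 < e / 2 / (size r).+1%:R by rewrite divr_gt0.
have /choice[Q hQ] i := rat_complex_approx (y i) (wt_gt0 R i) d0.
exists [seq (i, Q i) | i <- r]; rewrite /target /pattern_sum big_map.
set t : lp p1 := \sum_(i <- r) _ in hr; set u : lp p1 := \sum_(i <- r) _.
have -> : y - u = (y - t) + (t - u) by rewrite addrA subrK.
rewrite -sumrB.
apply: le_lt_trans (lp_normD _ _) _.
rewrite [ltRHS](splitr e); apply: ltr_leD; first exact: hr.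
apply: le_trans (lp_norm_sum _ _) _.
apply: (@le_trans _ _ (\sum_(i <- r) e / 2 / (size r).+1%:R)).
  apply: ler_sum => i _; rewrite /weighted_basis scalerA -scalerBl lp_normZ.
  rewrite -[leRHS]mulr1; apply: ler_pM; rewrite ?normc_ge0 ?lp_norm_ge0//.
    exact: ltW.
  exact: lp_norm_basis.
rewrite big_const_seq count_predT iter_addr_0 -[leLHS]mulr_natr mulrAC ler_pdivrMr//.
by rewrite ler_pM2l// ler_nat.
Qed.

Lemma wshift_weakly_hypercyclic : weakly_hypercyclic (T : lp p1 -> lp p1).
Proof.
exists hypercyclic_vector => O [y Oy] oO.
have [fs [e [e0 hO]]] := weak_open_basic oO Oy.
have eR : e = (complex.Re e)%:C by rewrite RRe_real// gtr0_real.
set d := complex.Re e in eR; have d0 : 0 < d by rewrite -ltcR -eR.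
have d2 : 0 < d / 2 by rewrite divr_gt0.
have [M M0 hM] := duals_bound fs.
have M1 : 0 < M + 1 by rewrite ltr_wpDl.
have [|s hs] := @target_dense y (d / 2 / (M + 1)); first by rewrite divr_gt0.
have [N hN] := error_weakly_small fs d2.
have [b Nb sb] := schedule_recurs s N.
have [k kb hk] := hN b Nb.
exists (iter (4 ^ k) T hypercyclic_vector); split; last by exists (4 ^ k)%N.
apply: hO; rewrite eR.
have -> : \sum_(f <- fs) `|f (iter (4 ^ k) T hypercyclic_vector) - f y| =
    (\sum_(f <- fs) normc (f (error k - (y - target s))))%:C.
  rewrite rmorph_sum; apply: eq_bigr => f _; rewrite -linearB.
  rewrite (_ : _ - y = error k - (y - target s))//.
  by rewrite /error (scale_block kb) sb opprB addrA subrK.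
rewrite ltcR.
apply: (@le_lt_trans _ _ (\sum_(f <- fs) normc (f (error k)) +
   \sum_(f <- fs) normc (f (y - target s)))).
  rewrite -big_split; apply: ler_sum => f _; rewrite linearB.
  by apply: le_trans (le_normcD _ _) _; rewrite normcN.
rewrite (splitr d); apply: ltr_leD => //; apply: le_trans (hM _) _.
apply: (@le_trans _ _ ((M + 1) * lp_norm p (y - target s))).
  by rewrite ler_wpM2r ?lp_norm_ge0// lerDl.
by rewrite mulrC -ler_pdivlMr// ltW.
Qed.

End hyper.

(** * The theorem *)

Local Close Scope complex_scope.
Local Close Scope classical_set_scope.

(* p1 is implied by p2; it indexes the normed space lp p1. *)
Theorem proposition1p9 (R : realType) (p : R) (p1 : 1 <= p) (p2 : 2 < p) :
  exists (w : int -> R[i]) (T : {linear lp p1 -> lp p1}),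
    [/\ bilateral_weighted_shift w T, weakly_hypercyclic T & ~ supercyclic T].
Proof.
exists (fun n => (wt R (n - 1) / wt R n)%:C%C), (@wshift R p p1); split.
- exact: wshift_weighted.
- exact: wshift_weakly_hypercyclic.
- exact: wshift_not_supercyclic.
Qed.
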